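(* Let $\lambda$ be a nonzero real number and let $x\in\mathbb{R}$. For every integer $n\ge 0$, $$D_{n,\lambda}(x)=\frac{1}{n+1}\sum_{m=0}^{n}(m+1)\,(x)_{m,\lambda}\,S_{1,\lambda}(n+1,m+1).$$
   Context: Generating functions are power series in $t$ (formal, or convergent for $|t|$ small), with $(1+t)^{x}=\sum_{n\ge 0}(x)_n\frac{t^n}{n!}$, where $(x)_0=1$ and $(x)_n=x(x-1)\cdots(x-n+1)$ for $n\ge1$. Also $(x)_{0,\lambda}=1$ and $(x)_{n,\lambda}=x(x-\lambda)\cdots(x-(n-1)\lambda)$ for $n\ge 1$. The degenerate logarithm is $\log_\lambda(1+t)=\frac{1}{\lambda}\left((1+t)^\lambda-1\right)$. The degenerate Daehee polynomials $D_{n,\lambda}(x)$ are defined by $\frac{\log_\lambda(1+t)}{t}(1+t)^x=\sum_{n=0}^\infty D_{n,\lambda}(x)\frac{t^n}{n!}$. The degenerate Stirling numbers of the first kind $S_{1,\lambda}(n,l)$ are defined by the polynomial identity in $x$: $(x)_n=\sum_{l=0}^n S_{1,\lambda}(n,l)(x)_{l,\lambda}$ for $n\ge0$. *)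

(* Defs.v *)
From Stdlib Require Import Arith Reals Lra Lia.
From Coquelicot Require Import Coquelicot.

Open Scope R_scope.

(* A power series in t is represented, as in Coquelicot's PSeries library, by
   the sequence of its coefficients (a n is the coefficient of t^n), and is
   treated formally: no convergence is required. *)

Fixpoint falling (x : R) (n : nat) : R :=
  match n with
  | 0%nat => 1
  | S k => falling x k * (x - INR k)
  end.

(* (x)_{n,lambda} = x (x - lambda) ... (x - (n-1) lambda) *)
Fixpoint deg_falling (lambda x : R) (n : nat) : R :=
  match n with
  | 0%nat => 1
  | S k => deg_falling lambda x k * (x - INR k * lambda)
  end.

Definition ps_one (n : nat) : R :=
  match n with 0%nat => 1 | S _ => 0 end.

(* (1+t)^x = sum_n (x)_n t^n / n! *)
Definition ps_pow1p (x : R) (n : nat) : R := falling x n / INR (fact n).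

(* log_lambda(1+t) = ((1+t)^lambda - 1) / lambda *)
Definition ps_deg_log (lambda : R) : nat -> R :=
  PS_scal (/ lambda) (PS_minus (ps_pow1p lambda) ps_one).

(* (log_lambda(1+t) / t) (1+t)^x.  PS_decr_1 shifts the coefficients down by
   one; this is division by t because log_lambda(1+t) has no constant term,
   see deg_log_div_t. *)
Definition deg_daehee_gf (lambda x : R) : nat -> R :=
  PS_mult (PS_decr_1 (ps_deg_log lambda)) (ps_pow1p x).

(* D_{n,lambda}(x), read off from the exponential generating function; see
   deg_daehee_egf. *)
Definition deg_daehee (lambda : R) (n : nat) (x : R) : R :=
  INR (fact n) * deg_daehee_gf lambda x n.

(* The values S1 n l with l > n are left unconstrained. *)
Definition is_deg_stirling1 (lambda : R) (S1 : nat -> nat -> R) : Prop :=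
  forall (n : nat) (x : R),
    falling x n = sum_f_R0 (fun l => S1 n l * deg_falling lambda x l) n.

Lemma deg_log_div_t (lambda : R) (n : nat) :
  PS_incr_1 (PS_decr_1 (ps_deg_log lambda)) n = ps_deg_log lambda n.
Proof.
destruct n as [|n]; [|reflexivity].
change (0 = / lambda * (1 / 1 + - (1))); lra.
Qed.

Lemma deg_daehee_egf (lambda x : R) (n : nat) :
  deg_daehee_gf lambda x n = deg_daehee lambda n x / INR (fact n).
Proof. unfold deg_daehee; field; apply INR_fact_neq_0. Qed.

Lemma deg_stirling1_exists (lambda : R) :
  exists S1 : nat -> nat -> R, is_deg_stirling1 lambda S1.
Proof.
cut (forall n, {c : nat -> R | forall x,
  falling x n = sum_f_R0 (fun l => c l * deg_falling lambda x l) n}).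
{ intros H; exists (fun n => proj1_sig (H n)); exact (fun n => proj2_sig (H n)). }
induction n as [|n [c Hc]].
{ exists (fun _ => 1); intros x; simpl; ring. }
exists (fun l => (match l with 0%nat => 0 | S k => c k end)
  + (if Nat.leb l n then c l * (INR l * lambda - INR n) else 0)).
intros x; cbn [falling]; rewrite Hc.
symmetry; transitivity (sum_f_R0 (fun l =>
  match l with 0%nat => 0 | S k => c k end * deg_falling lambda x l
  + (if Nat.leb l n then c l * (INR l * lambda - INR n) else 0)
    * deg_falling lambda x l) (S n)).
{ apply sum_eq; intros; ring. }
rewrite sum_plus, (decomp_sum _ (S n)) by lia.
cbn [Nat.pred]; rewrite tech5.
replace (Nat.leb (S n) n) with false by (symmetry; apply Nat.leb_gt; lia).
rewrite 2!Rmult_0_l, Rplus_0_l, Rplus_0_r, <- sum_plus, Rmult_comm, scal_sum.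
apply sum_eq; intros i Hi.
replace (Nat.leb i n) with true by (symmetry; apply Nat.leb_le; lia).
cbn [deg_falling]; ring.
Qed.

Lemma deg_falling_zero (lambda : R) (k l : nat) :
  (k < l)%nat -> deg_falling lambda (INR k * lambda) l = 0.
Proof.
induction l as [|l IH]; intros Hkl; [lia|]; cbn [deg_falling].
destruct (Nat.eq_dec k l) as [->|Hn]; [|rewrite IH by lia]; ring.
Qed.

Lemma deg_falling_neq0 (lambda : R) (k l : nat) :
  lambda <> 0 -> (l <= k)%nat -> deg_falling lambda (INR k * lambda) l <> 0.
Proof.
intros Hlam; induction l as [|l IH]; intros Hkl; cbn [deg_falling]; [lra|].
apply Rmult_integral_contrapositive_currified; [apply IH; lia|].
rewrite <- Rmult_minus_distr_r.
apply Rmult_integral_contrapositive_currified; [|exact Hlam].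
apply Rminus_eq_contra, not_INR; lia.
Qed.

Lemma deg_stirling1_unique (lambda : R) (S1 S2 : nat -> nat -> R) :
  lambda <> 0 -> is_deg_stirling1 lambda S1 -> is_deg_stirling1 lambda S2 ->
  forall n l, (l <= n)%nat -> S1 n l = S2 n l.
Proof.
intros Hlam H1 H2 n l.
induction l as [l IH] using (well_founded_induction Wf_nat.lt_wf); intros Hl.
assert (H : sum_f_R0 (fun i => (S1 n i - S2 n i)
                * deg_falling lambda (INR l * lambda) i) n = 0).
{ rewrite (sum_eq _ (fun i => S1 n i * deg_falling lambda (INR l * lambda) i
    - S2 n i * deg_falling lambda (INR l * lambda) i)) by (intros; ring).
  rewrite minus_sum, <- H1, <- H2; ring. }
assert (Hz : forall m, (l <= m)%nat -> sum_f_R0 (fun i => (S1 n i - S2 n i)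
  * deg_falling lambda (INR l * lambda) i) m
  = (S1 n l - S2 n l) * deg_falling lambda (INR l * lambda) l).
{ induction m as [|m IHm]; intros Hm.
  - now replace l with 0%nat by lia.
  - rewrite tech5; destruct (Nat.eq_dec l (S m)) as [->|Hn].
    + rewrite (sum_eq _ (fun _ => 0)).
      * rewrite sum_cte; ring.
      * intros i Hi; rewrite (IH i) by lia; ring.
    + rewrite IHm, (deg_falling_zero lambda l (S m)) by lia; ring. }
rewrite Hz in H by exact Hl.
destruct (Rmult_integral _ _ H) as [H0|H0]; [lra|].
now apply deg_falling_neq0 in H0.
Qed.

(* Main.v *)
Require Import Defs.
From Stdlib Require Import Reals Lra Lia.
From Coquelicot Require Import Coquelicot.
Open Scope R_scope.

(** Multiplying the defining generating function by [t] turns it into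
    [((1+t)^(x+lambda) - (1+t)^x) / lambda], because powers of [1+t] multiply
    by adding exponents ([ps_pow1p_add], the Chu-Vandermonde identity).
    Comparing coefficients, [D_{n,lambda}(x)] is [1/(n+1)] times the difference
    quotient with step [lambda] of the falling factorial [(x)_{n+1}]
    ([deg_daehee_difference_quotient]).

    The step-[lambda] difference quotient acts on the degenerate falling
    factorials as differentiation acts on monomials: it maps [(x)_{l+1,lambda}]
    to [(l+1) (x)_{l,lambda}] ([deg_falling_difference]).  Applying it to each
    term of the Stirling expansion of [(x)_{n+1}] gives the formula. *)

(** The coefficientwise form of [(1+t) f' = x f] for [f = (1+t)^x]. *)
Lemma ps_pow1p_succ (x : R) (n : nat) :
  INR (S n) * ps_pow1p x (S n) = (x - INR n) * ps_pow1p x n.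
Proof.
unfold ps_pow1p; cbn [falling]; rewrite fact_simpl, mult_INR.
field; split; [apply INR_fact_neq_0 | apply not_0_INR; lia].
Qed.

(** The product satisfies the recurrence [ps_pow1p_succ] for the exponent
    [x + y]; since that recurrence and the constant term determine the series,
    the two sides agree. *)
Lemma ps_pow1p_add (x y : R) (n : nat) :
  PS_mult (ps_pow1p x) (ps_pow1p y) n = ps_pow1p (x + y) n.
Proof.
induction n as [|n IH]; [unfold PS_mult, ps_pow1p; simpl; field|].
apply (Rmult_eq_reg_l (INR (S n))); [|apply not_0_INR; lia].
rewrite ps_pow1p_succ, <- IH; unfold PS_mult.
(* The factor n+1 is distributed as k + (n+1-k), the Leibniz rule for t d/dt. *)
transitivity
  (sum_f_R0 (fun k => INR k * ps_pow1p x k * ps_pow1p y (S n - k)) (S n)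
   + sum_f_R0 (fun k => ps_pow1p x k
                        * (INR (S n - k) * ps_pow1p y (S n - k))) (S n)).
{ rewrite <- sum_plus, scal_sum; apply sum_eq; intros k Hk.
  rewrite minus_INR by exact Hk; ring. }
rewrite (decomp_sum _ (S n)) by lia; rewrite (tech5 _ n); cbn [Nat.pred].
rewrite Nat.sub_diag; change (INR 0) with 0.
rewrite !Rmult_0_l, Rmult_0_r, Rplus_0_l, Rplus_0_r, <- sum_plus, scal_sum.
apply sum_eq; intros k Hk.
rewrite ps_pow1p_succ; cbn [Nat.sub].
replace (match k with 0%nat => S n | S l => (n - l)%nat end)
  with (S (n - k)) by (destruct k; lia).
rewrite ps_pow1p_succ, minus_INR by exact Hk; ring.
Qed.

Lemma deg_daehee_difference_quotient (lambda x : R) (n : nat) :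
  lambda <> 0 ->
  deg_daehee lambda n x =
    1 / INR (S n) * ((falling (x + lambda) (S n) - falling x (S n)) / lambda).
Proof.
intros Hlam.
assert (Hgf : deg_daehee_gf lambda x n =
  / lambda * (ps_pow1p (x + lambda) (S n) - ps_pow1p x (S n))).
{ rewrite Rplus_comm, <- ps_pow1p_add.
  unfold deg_daehee_gf, PS_mult.
  rewrite (decomp_sum _ (S n)) by lia; cbn [Nat.pred Nat.sub].
  replace (ps_pow1p lambda 0) with 1 by (unfold ps_pow1p; simpl; field).
  rewrite Rmult_1_l, Rplus_comm; unfold Rminus.
  rewrite Rplus_assoc, Rplus_opp_r, Rplus_0_r, scal_sum.
  apply sum_eq; intros k Hk.
  change (PS_decr_1 (ps_deg_log lambda) k)
    with (/ lambda * (ps_pow1p lambda (S k) + - 0)); ring. }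
unfold deg_daehee; rewrite Hgf; unfold ps_pow1p.
rewrite fact_simpl, mult_INR.
field; repeat split;
  [exact Hlam | apply not_0_INR; lia | apply INR_fact_neq_0].
Qed.

(** Shifting the argument by [lambda] adds a new first factor and drops the
    last one. *)
Lemma deg_falling_shift (lambda x : R) (l : nat) :
  deg_falling lambda (x + lambda) (S l) = (x + lambda) * deg_falling lambda x l.
Proof.
induction l as [|l IH]; [simpl; ring|].
change (deg_falling lambda (x + lambda) (S (S l)))
  with (deg_falling lambda (x + lambda) (S l)
        * (x + lambda - INR (S l) * lambda)).
rewrite IH, S_INR; cbn [deg_falling]; ring.
Qed.

Lemma deg_falling_difference (lambda x : R) (l : nat) :
  deg_falling lambda (x + lambda) (S l) - deg_falling lambda x (S l)
  = lambda * (INR (S l) * deg_falling lambda x l).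
Proof. rewrite deg_falling_shift, S_INR; cbn [deg_falling]; ring. Qed.

Theorem theorem2p4 (lambda : R) (hlambda : lambda <> 0)
    (S1 : nat -> nat -> R) (hS1 : is_deg_stirling1 lambda S1)
    (x : R) (n : nat) :
  deg_daehee lambda n x =
    1 / INR (n + 1) *
    sum_f_R0 (fun m => INR (m + 1) * deg_falling lambda x m
                       * S1 (n + 1)%nat (m + 1)%nat) n.
Proof.
rewrite deg_daehee_difference_quotient by exact hlambda.
replace (n + 1)%nat with (S n) by lia; f_equal.
rewrite !hS1, <- minus_sum.
(* The constant term l = 0 of the Stirling expansion has zero difference. *)
rewrite (decomp_sum _ (S n)) by lia; cbn [Nat.pred].
change (deg_falling lambda (x + lambda) 0) with (deg_falling lambda x 0).
rewrite Rminus_diag, Rplus_0_l; unfold Rdiv; rewrite Rmult_comm, scal_sum.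
apply sum_eq; intros m Hm.
replace (m + 1)%nat with (S m) by lia.
rewrite <- Rmult_minus_distr_l, deg_falling_difference.
field; exact hlambda.
Qed.
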